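(* For integers $d\geq1$ and $k\geq2$, there exists a constant $C=C(k)$ such that the following holds. Let $G=G(V,E)$ be a tree with vertex set $V=\{v_1,v_2,\ldots,v_{k+1}\}$. If $A_1,A_2,\ldots,A_{k+1}\subseteq\mathbb{F}_q^d$ and $|A_i||A_j|\geq Cq^{d+k-1}$ for every $\{v_i,v_j\}\in E$, then $\Pi_G(A_1\times A_2\times\cdots\times A_{k+1})\supseteq(\mathbb{F}_q^* )^k$.
   Context: $\mathbb{F}_q$ is the finite field with $q$ elements, $\mathbb{F}_q^*=\mathbb{F}_q\setminus\{0\}$, and for $x,y\in\mathbb{F}_q^d$, $x\cdot y=\sum_{i=1}^d x_iy_i$. For a graph $G=(V,E)$ with $V=\{v_1,\ldots,v_n\}$ and $S\subseteq(\mathbb{F}_q^d)^n$, $\Pi_G(S)$ is the set of functions $\alpha:E\to\mathbb{F}_q$ (viewed as vectors in $(\mathbb{F}_q)^E$) such that there exists $(x_1,\ldots,x_n)\in S$ with $x_i\cdot x_j=\alpha(\{v_i,v_j\})$ for every $\{v_i,v_j\}\in E$. Since a tree on $k+1$ vertices has $k$ edges, $(\mathbb{F}_q^* )^k$ here denotes the set of functions $E\to\mathbb{F}_q^*$. *)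

(* Defs.v *)
From HB Require Import structures.
From mathcomp Require Import all_boot all_order all_algebra.
From mathcomp Require Import reals.

Set Implicit Arguments.
Unset Strict Implicit.
Unset Printing Implicit Defensive.

Import Order.TTheory GRing.Theory Num.Theory.
Local Open Scope ring_scope.

Record sgraph (V : finType) := SGraph {
  edge_set : {set {set V}};
  edge_set_card2 : forall e, e \in edge_set -> #|e| = 2 }.

Definition edge (V : finType) (G : sgraph V) := {e : {set V} | e \in edge_set G}.

(* Symmetric because [set u; v] = [set v; u], and irreflexive because
   [set u; u] has only one element. *)
Definition adj (V : finType) (G : sgraph V) : rel V :=
  fun u v => [set u; v] \in edge_set G.

Definition connected_graph (V : finType) (G : sgraph V) : Prop :=
  (0 < #|V|)%N /\ forall u v : V, connect (adj G) u v.

(* An edge {u, v} yields the ucycle [:: u; v]; cycles of a graph are the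
   ucycles with at least three vertices. *)
Definition acyclic_graph (V : finType) (G : sgraph V) : Prop :=
  forall c : seq V, ucycle (adj G) c -> (size c < 3)%N.

Definition is_tree (V : finType) (G : sgraph V) : Prop :=
  connected_graph G /\ acyclic_graph G.

Definition dotp (F : finFieldType) (d : nat) (x y : 'rV[F]_d) : F :=
  \sum_(i < d) x 0 i * y 0 i.

(* The set Pi_G(S); dotp being symmetric, it does not matter which of the two
   orderings of the endpoints of an edge is used. *)
Definition Pi_graph (F : finFieldType) (d : nat) (V : finType) (G : sgraph V)
    (S : {set {ffun V -> 'rV[F]_d}}) : {set {ffun edge G -> F}} :=
  [set alpha : {ffun edge G -> F} |
    [exists x in S, forall e : edge G, forall u : V, forall v : V,
       (val e == [set u; v]) ==> (dotp (x u) (x v) == alpha e)]].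

Definition prod_sets (T V : finType) (A : V -> {set T}) :
    {set {ffun V -> T}} :=
  [set x : {ffun V -> T} | [forall v, x v \in A v]].

Definition nonzero_labels (F : finFieldType) (V : finType) (G : sgraph V) :
    {set {ffun edge G -> F}} :=
  [set alpha : {ffun edge G -> F} | [forall e, alpha e != 0]].

(* Main.v *)
(** For [t <> 0], a second moment computation shows that at most
    [2 q^(d+1) / |S|] points have no dot product equal to [t] with a point of
    [S].  Hence, for an edge [{i, j}] with [|A_i| |A_j| >= C q^(d+1)], all but a
    small fraction of [A_i] can be matched into any subset of [A_j] of at least
    half its size.  Rooting the tree and pruning each [A_i] from the leaves up,
    every set keeps at least half of its points, and an embedding is then read
    off from the root down.  Since [k >= 2], the exponent [d + k - 1] is at
    least [d + 1]. *)

Require Import Defs.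
From HB Require Import structures.
From mathcomp Require Import all_boot all_order all_algebra.
From mathcomp Require Import reals.
From mathcomp Require Import zify ring.

Set Implicit Arguments.
Unset Strict Implicit.
Unset Printing Implicit Defensive.

Import Order.TTheory GRing.Theory Num.Theory.
Local Open Scope ring_scope.

(** * Counting the points that miss a given dot product with a set *)

Section DotProduct.

Variables (F : finFieldType) (d : nat).
Implicit Types x y z : 'rV[F]_d.

Lemma dotpC x y : dotp x y = dotp y x.
Proof. by apply: eq_bigr => i _; rewrite mulrC. Qed.

Lemma dotpDl x z y : dotp (x + z) y = dotp x y + dotp z y.
Proof. by rewrite -big_split; apply: eq_bigr => i _; rewrite mxE mulrDl. Qed.

Lemma dotpZl a x y : dotp (a *: x) y = a * dotp x y.
Proof. by rewrite /dotp mulr_sumr; apply: eq_bigr => i _; rewrite mxE mulrA. Qed.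

Lemma dotpBr x y z : dotp x (y - z) = dotp x y - dotp x z.
Proof.
by rewrite !(dotpC x) -scaleN1r dotpDl dotpZl mulN1r.
Qed.

Lemma exists_dotp1 y : y != 0 -> exists z, dotp z y = 1.
Proof.
move=> y0; have [i yi] : exists i, y 0 i != 0.
  apply/existsP; apply: contraR y0; rewrite negb_exists => /forallP y0.
  by apply/eqP/rowP => i; rewrite mxE; apply/eqP; have := y0 i; rewrite negbK.
exists ((y 0 i)^-1 *: delta_mx 0 i).
rewrite dotpZl /dotp (bigD1 i) //= big1 => [|j ji].
  by rewrite addr0 mxE !eqxx mul1r mulVf.
by rewrite mxE eqxx (negbTE ji) mul0r.
Qed.

Lemma card_rV : #|{: 'rV[F]_d}| = (#|F| ^ d)%N.
Proof. by rewrite card_mx mul1n. Qed.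

(** For [z] with [dotp z y = 1], the map [(a, x) -> x + a z] is a bijection from [F] times the
    hyperplane onto the whole space. *)
Lemma card_hyperplane y (t : F) : y != 0 ->
  (#|F| * #|[set x | dotp x y == t]| = #|F| ^ d)%N.
Proof.
move=> /exists_dotp1[z zy].
rewrite -card_rV -cardsT -cardsX.
rewrite -(card_in_imset (f := fun p : F * 'rV[F]_d => p.2 + p.1 *: z)).
  rewrite -cardsT; congr #|pred_of_set _|; apply/setP => x; rewrite inE.
  apply/imsetP; exists (dotp x y - t, x - (dotp x y - t) *: z).
    by rewrite !inE /= -scaleNr dotpDl dotpZl zy; apply/eqP; ring.
  by rewrite /= subrK.
move=> [a x] [b x'] /setXP[_] /=; rewrite inE => /eqP xt /setXP[_] /=.
rewrite inE => /eqP xt' e.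
have := congr1 (fun v => dotp v y) e; rewrite !dotpDl !dotpZl zy xt xt' !mulr1.
by move=> /addrI ab; move: e; rewrite ab => /addIr ->.
Qed.

(** If the intersection contains some [x0], then [(a, b, x) -> x + a x0 + b z] is injective on it,
    where [dotp z (y - y') = 1]: comparing the products with [y] and [y'] recovers [b], and the
    product with [y] then recovers [a t], hence [a]. *)
Lemma card_two_hyperplanes y y' (t : F) : t != 0 -> y != y' ->
  (#|F| ^ 2 * #|[set x | (dotp x y == t) && (dotp x y' == t)]| <= #|F| ^ d)%N.
Proof.
move=> t0 yy'; set H := [set x | _].
have [->|[x0]] := set_0Vmem H; first by rewrite cards0 muln0.
rewrite inE => /andP[/eqP x0y /eqP x0y'].
have [z] : exists z, dotp z (y - y') = 1 by apply: exists_dotp1; rewrite subr_eq0.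
rewrite dotpBr => zy.
rewrite -mulnn -card_rV -cardsT -!cardsX.
rewrite -(card_in_imset (f := fun p : F * F * 'rV[F]_d =>
   p.2 + (p.1.1 *: x0 + p.1.2 *: z))); first by rewrite -cardsT subset_leq_card ?subsetT.
move=> [[a b] x] [[a' b'] x'] /setXP[_] /=; rewrite inE => /andP[/eqP xy /eqP xy'].
move=> /setXP[_] /=; rewrite inE => /andP[/eqP x'y /eqP x'y'] e.
have e1 := congr1 (fun v => dotp v y) e; have e2 := congr1 (fun v => dotp v y') e.
rewrite !dotpDl !dotpZl in e1 e2.
rewrite xy x'y x0y in e1; rewrite xy' x'y' x0y' in e2.
have eb : b = b'.
  rewrite -[b]mulr1 -[b']mulr1 -zy.
  have -> : b * (dotp z y - dotp z y') =
    t + (a * t + b * dotp z y) - (t + (a * t + b * dotp z y')) by ring.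
  by rewrite e1 e2; ring.
subst b'; have ea : a = a' by apply: (mulIf t0); move/addrI/addIr: e1.
by subst a'; move/addIr: e => ->.
Qed.

Definition undotted (S : {set 'rV[F]_d}) (t : F) : {set 'rV[F]_d} :=
  [set x | [forall y in S, dotp x y != t]].

Lemma card_undotted_nz (S : {set 'rV[F]_d}) (t : F) : t != 0 -> 0 \notin S ->
  (#|undotted S t| * #|S| <= #|F| ^ d.+1)%N.
Proof.
move=> t0 S0; set B := undotted S t; set s := #|S|; set q := #|F|.
set Q := (q ^ d)%N.
(* The random variable of the second moment method; its mean over the space is [s / q]. *)
pose N x := (\sum_(y in S) (dotp x y == t))%N.
have card_sum (P : pred 'rV[F]_d) : #|[set x | P x]| = (\sum_x P x)%N.
  by rewrite -sum1dep_card big_mkcond; apply: eq_bigr => x _; case: (P x).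
have sumN : (q * \sum_x N x = s * Q)%N.
  rewrite exchange_big big_distrr /= /s -sum1_card big_distrl /=.
  apply: eq_bigr => y yS; rewrite -card_sum mul1n card_hyperplane //.
  by apply: contraNneq S0 => <-.
have sumN2 : (q ^ 2 * \sum_x N x ^ 2 <= s ^ 2 * Q + q * s * Q)%N.
  have -> : (\sum_x N x ^ 2 = \sum_(y in S) \sum_(y' in S)
      #|[set x | (dotp x y == t) && (dotp x y' == t)]|)%N.
    under [RHS]eq_bigr do under eq_bigr do rewrite card_sum.
    under [RHS]eq_bigr do rewrite exchange_big /=.
    rewrite [RHS]exchange_big; apply: eq_bigr => x _.
    rewrite -mulnn /N big_distrl; apply: eq_bigr => y _ /=.
    by rewrite big_distrr; apply: eq_bigr => y' _; rewrite -mulnb.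
  (* After scaling by [q ^ 2], for fixed [y] each [y'] other than [y] contributes at most [Q], and
     the diagonal term contributes [q Q]. *)
  rewrite (_ : s ^ 2 * Q + q * s * Q = \sum_(y in S) (s * Q + q * Q))%N; last first.
    by rewrite sum_nat_const -/s; nia.
  rewrite big_distrr; apply: leq_sum => y yS /=.
  rewrite (bigD1 y) //= mulnDr addnC leq_add //.
    rewrite big_distrr /= /s -sum_nat_const.
    rewrite [X in (_ <= X)%N](bigD1 y) //=; apply: leq_trans (leq_addl _ _).
    apply: leq_sum => y' /andP[_ yy'].
    by apply: card_two_hyperplanes => //; rewrite eq_sym.
  have -> : [set x | (dotp x y == t) && (dotp x y == t)] = [set x | dotp x y == t].
    by apply/setP => x; rewrite !inE andbb.
  rewrite -mulnn -mulnA card_hyperplane //.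
  by apply: contraNneq S0 => <-.
(* Expand [0 <= \sum_x (q N(x) - s)^2], whose terms with [x \in B] are [s^2]. *)
have var : (s ^ 2 * #|B| <= q * s * Q)%N.
  have : (2 * s * (q * \sum_x N x) + s ^ 2 * #|B| <=
          q ^ 2 * \sum_x N x ^ 2 + s ^ 2 * Q)%N.
    rewrite /B /undotted card_sum /Q -card_rV -sum1_card !big_distrr -!big_split /=.
    apply: leq_sum => x _; rewrite muln1.
    case: forall_inP => [xB|_]; last first.
      by rewrite muln0 addn0 -mulnA -expnMn [(s * _)%N]mulnC nat_Cauchy.
    rewrite /N big1 => [|y /xB /negbTE -> //].
    by rewrite !muln0; lia.
  rewrite sumN; nia.
have [->|s0] := posnP s; first by rewrite muln0.
rewrite -(leq_pmul2r s0) expnS; move: var; rewrite -/q -/Q; nia.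
Qed.

(** The zero vector is discarded from [S]. This lowers [#|S|] by at most one, and the resulting
    extra term [b] is itself at most [#|F| ^ d.+1], whence the factor 2. *)
Lemma card_undotted (S : {set 'rV[F]_d}) (t : F) : t != 0 ->
  (#|undotted S t| * #|S| <= 2 * #|F| ^ d.+1)%N.
Proof.
move=> t0; have S0 : 0 \notin S :\ 0 by rewrite !inE eqxx.
have sub : (#|undotted S t| <= #|undotted (S :\ 0%R) t|)%N.
  apply/subset_leq_card/subsetP => x; rewrite !inE => /forall_inP xB.
  by apply/forall_inP => y /setD1P[_]; apply: xB.
have := card_undotted_nz t0 S0; set b := #|undotted (S :\ 0) t| in sub *.
have : (b <= #|F| ^ d.+1)%N.
  rewrite expnS; apply: (@leq_trans (#|F| ^ d)%N); first by rewrite -card_rV max_card.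
  by apply: leq_pmull; apply/card_gt0P; exists (0 : F).
have : (#|S| <= #|S :\ 0%R|.+1)%N by rewrite (cardsD1 0%R S); case: (_ \in S).
by move: sub; clear; nia.
Qed.

End DotProduct.

(** * Embedding a tree by adding one leaf at a time *)

Section TreeEmbedding.

Variables (V : finType) (G : sgraph V).

Lemma adjC : symmetric (adj G).
Proof. by move=> u v; rewrite /adj setUC. Qed.

Lemma adj_irrefl : irreflexive (adj G).
Proof.
move=> u; apply/negP => /edge_set_card2; rewrite setUid.
by rewrite cards1.
Qed.

Definition adj_in (U : {set V}) : rel V :=
  fun u v => [&& u \in U, v \in U & adj G u v].

Lemma sub_adj_in (U W : {set V}) : U \subset W -> subrel (adj_in U) (adj_in W).
Proof.
by move=> /subsetP UW u v /and3P[/UW uW /UW vW uv]; apply/and3P.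
Qed.

Definition conn_set (U : {set V}) :=
  {in U &, forall u v, connect (adj_in U) u v}.

Lemma conn_set_add (U : {set V}) p w :
  conn_set U -> p \in U -> adj G p w -> conn_set (w |: U).
Proof.
move=> cU pU pw.
have sU : connect_sym (adj_in (w |: U)).
  by apply: sym_connect_sym => u v; rewrite /adj_in adjC andbCA.
have to_p u : u \in w |: U -> connect (adj_in (w |: U)) p u.
  case/setU1P => [->|uU]; first by apply: connect1; rewrite /adj_in !inE eqxx pU orbT.
  apply: connect_sub (cU _ _ pU uU) => a b /(sub_adj_in (subsetUr [set w] U)).
  exact: connect1.
by move=> u v /to_p pu /to_p; apply: connect_trans; rewrite sU.
Qed.

(** Otherwise a simple path from [a] to [b] inside [U] closes up through [w] into a cycle with at
    least three vertices. *)
Lemma acyclic_unique_nbr (U : {set V}) w a b :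
  acyclic_graph G -> conn_set U -> w \notin U ->
  a \in U -> b \in U -> adj G a w -> adj G b w -> a = b.
Proof.
move=> acG cU wU aU bU aw bw; apply/eqP/negPn/negP => ab.
have /connectP[p0 p0P bE] := cU _ _ aU bU.
case: (shortenP p0P) bE => p pP pU _ bE {p0 p0P}.
have sub_U c : path (adj_in U) a c -> {subset c <= U}.
  elim: c {pP pU bE aw ab aU} a => // x c IH a /= /andP[/and3P[_ xU _] /IH cU'].
  by move=> y /predU1P[->|/cU'].
have pG : path (adj G) a p by apply: sub_path pP => u v /and3P[].
have := acG (w :: a :: p).
case: p pP pU bE pG => [|x p] pP pU bE pG; first by rewrite bE eqxx in ab.
suff uc : ucycle (adj G) [:: w, a, x & p] by move=> /(_ uc).
apply/andP; split.
  rewrite /= adjC aw rcons_path; move: pG => /= /andP[-> ->].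
  by move: bE => /= <-.
rewrite cons_uniq pU andbT; apply/negP => /predU1P[wa|/(sub_U _ pP) wU'].
  by rewrite wa aU in wU.
by rewrite wU' in wU.
Qed.

Lemma exists_frontier (U : {set V}) v : connected_graph G -> v \in U ->
  U != setT -> exists p w, [/\ p \in U, w \notin U & adj G p w].
Proof.
move=> [_ cG] vU UT; have [w wU] : exists w, w \notin U.
  apply/existsP; apply: contraR UT; rewrite negb_exists => /forallP allU.
  by apply/eqP/setP => w; rewrite inE; have := allU w; rewrite negbK.
have /connectP[c cP wE] := cG v w; elim: c v vU cP wE => [|x c IH] v vU /=.
  by move=> _ wv; rewrite wv vU in wU.
move=> /andP[vx xP] wE; have [xU|xU] := boolP (x \in U); first exact: IH xP wE.
by exists v, x.
Qed.

Variables (T : finType) (A : V -> {set T}) (r : V -> V -> T -> T -> bool).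
Hypothesis rC : forall u v x y, r u v x y = r v u y x.

Definition unmatched u v (B : {set T}) : {set T} :=
  [set x in A u | [forall y in B, ~~ r u v x y]].

Definition embeds_on (U : {set V}) (B : V -> {set T}) :=
  exists x : {ffun V -> T}, {in U, forall v, x v \in B v} /\
    {in U &, forall u v, adj G u v -> r u v (x u) (x v)}.

(* Each of the at most [#|V|] neighbours of [v] may cost [A v] a fraction
   [1 / (2 #|V|)] of its points, so at least half of [A v] always survives. *)
Definition lightly_pruned (n : nat) (B : V -> {set T}) :=
  forall v, B v \subset A v /\ (2 * #|V| * #|A v :\: B v| <= n * #|A v|)%N.

Lemma lightly_pruned_half n B v : (n <= #|V|)%N -> lightly_pruned n B ->
  (#|A v| <= 2 * #|B v|)%N.
Proof.
move=> nV /(_ v)[/setIidPr BA bd].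
have V0 : (0 < #|V|)%N by apply/card_gt0P; exists v.
have AE := cardsID (B v) (A v); rewrite BA in AE.
suff : (2 * #|A v :\: B v| <= #|A v|)%N by lia.
rewrite -(leq_pmul2l V0); move: bd.
have : (n * #|A v| <= #|V| * #|A v|)%N by rewrite leq_mul2r nV orbT.
lia.
Qed.

Hypothesis treeG : is_tree G.
Hypothesis A_neq0 : forall v, A v != set0.
Hypothesis few_unmatched : forall u v (B : {set T}), adj G u v ->
  B \subset A v -> (#|A v| <= 2 * #|B|)%N ->
  (2 * #|V| * #|unmatched u v B| <= #|A u|)%N.

(** The new vertex [w] is a leaf attached to [p]. Points of [B p] without a partner in [B w] are
    removed before [U] is embedded, so a place for [w] remains afterwards. Quantifying over all
    lightly pruned [B] lets the hypothesis on [U] be applied to this smaller family. *)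
Lemma embeds_on_add (U : {set V}) p w :
  conn_set U -> p \in U -> w \notin U -> adj G p w ->
  (forall B, lightly_pruned #|~: U| B -> embeds_on U B) ->
  forall B, lightly_pruned #|~: (w |: U)| B -> embeds_on (w |: U) B.
Proof.
move=> cU pU wU pw embU B BP.
(* The pruning allowance of [U] exceeds that of [w |: U] by one unit, exactly the cost of pruning at
   [p]. *)
have cardC : #|~: U| = #|~: (w |: U)|.+1.
  rewrite (cardsD1 w) inE wU add1n; congr _.+1.
  by apply: eq_card => x; rewrite !inE negb_or.
have half := lightly_pruned_half w (max_card _) BP.
have few := few_unmatched pw (BP w).1 half.
pose B' v := if v == p then B p :\: unmatched p w (B w) else B v.
have B'B v : B' v \subset B v by rewrite /B'; case: eqP => // ->; rewrite subsetDl.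
have [|x [xB' xr]] := embU B'.
  move=> v; split; first exact: subset_trans (B'B v) (BP v).1.
  have := (BP v).2; rewrite cardC mulSn /B'; case: eqP => [->|_]; last first.
    by move/leq_trans; apply; rewrite leq_addl.
  have : (#|A p :\: (B p :\: unmatched p w (B w))| <=
          #|A p :\: B p| + #|unmatched p w (B w)|)%N.
    rewrite setDDr; apply: leq_trans (leq_card_setU _ _) _.
    by rewrite leq_add2l subset_leq_card ?subsetIr.
  have V2 : (0 < 2 * #|V|)%N by rewrite muln_gt0; apply/card_gt0P; exists p.
  rewrite -(leq_pmul2l V2) mulnDr => le1 le2.
  by apply: leq_trans le1 _; rewrite [leqLHS]addnC leq_add.
have [y yB ry] : exists2 y, y \in B w & r p w (x p) y.
  have := xB' _ pU; rewrite /B' eqxx => /setDP[xB].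
  rewrite inE (subsetP (BP p).1 _ xB) /= negb_forall_in => /exists_inP[y yB].
  by rewrite negbK; exists y.
exists [ffun v => if v == w then y else x v].
have neqw v : v \in U -> (v == w) = false.
  by move=> vU; apply: contraNF wU => /eqP <-.
split=> [v|u v].
  rewrite ffunE => /setU1P[->|vU]; first by rewrite eqxx.
  by rewrite neqw // (subsetP (B'B v)) ?xB'.
(* Any edge between [w] and [U] is the edge to [p], by acyclicity. *)
rewrite !ffunE => /setU1P[->|uU] /setU1P[->|vU]; rewrite ?eqxx ?neqw //.
- by rewrite adj_irrefl.
- rewrite adjC => vw; rewrite rC.
  by rewrite (acyclic_unique_nbr treeG.2 cU wU vU pU vw pw).
- by move=> uw; rewrite (acyclic_unique_nbr treeG.2 cU wU uU pU uw pw).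
- exact: xr.
Qed.

Lemma tree_embedding : exists x : {ffun V -> T},
  (forall v, x v \in A v) /\ forall u v, adj G u v -> r u v (x u) (x v).
Proof.
have [[V0 _] _] := treeG.
suff grow m : (m < #|V|)%N -> exists U : {set V}, [/\ #|U| = m.+1, conn_set U &
    forall B, lightly_pruned #|~: U| B -> embeds_on U B].
  case: (grow #|V|.-1); rewrite ?ltn_predL // prednK // => U [UV _].
  have -> : U = setT by apply/eqP; rewrite eqEcard subsetT cardsT UV /=.
  (* Once [U] is everything the allowance is zero, and the unpruned family [A] meets it. *)
  case/(_ A) => [v|x [xA xr]]; first by rewrite setDv cards0 muln0.
  by exists x; split=> *; [apply: xA | apply: xr].
elim: m => [_|m IH /[dup] mV /ltnW /IH[U [Um cU embU]]].
  have /card_gt0P[v _] := V0; exists [set v]; split; first exact: cards1.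
    by move=> u w /set1P -> /set1P ->; apply: connect0.
  move=> B BP; have half := lightly_pruned_half v (max_card _) BP.
  have /card_gt0P[x xB] : (0 < #|B v|)%N.
    by have := A_neq0 v; rewrite -card_gt0; lia.
  exists [ffun=> x]; split=> [u|u w] /set1P ->; rewrite ?ffunE //.
  by move=> /set1P ->; rewrite adj_irrefl.
have [v vU] : exists v, v \in U by apply/card_gt0P; rewrite Um.
have UT : U != setT by apply: contraTneq mV => UT; rewrite -Um UT cardsT ltnn.
have [p [w [pU wU pw]]] := exists_frontier treeG.1 vU UT.
exists (w |: U); split; first by rewrite cardsU1 wU Um.
  exact: conn_set_add cU pU pw.
exact: embeds_on_add pw embU.
Qed.

End TreeEmbedding.

(** * Applying the tree embedding to dot products *)

Theorem theorem4 (R : realType) (k : nat) (hk : (2 <= k)%N) :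
  exists C : R, 0 < C /\
    forall (d : nat) (F : finFieldType) (G : sgraph 'I_k.+1)
           (A : 'I_k.+1 -> {set 'rV[F]_d}),
      (1 <= d)%N ->
      is_tree G ->
      (forall i j : 'I_k.+1, [set i; j] \in edge_set G ->
         C * #|F|%:R ^+ (d + k - 1) <= #|A i|%:R * #|A j|%:R) ->
      nonzero_labels F G \subset Pi_graph G (prod_sets A).
Proof.
(* The factor [2 * k.+1] is the [2 * #|V|] of [few_unmatched]; the remaining 4 combines the 2 of
   [card_undotted] with the 2 lost by passing to half of [A v]. *)
exists (8 * k.+1)%:R; split; first by rewrite ltr0n.
move=> d F G A _ treeG cardA; apply/subsetP => alpha; rewrite inE => /forallP alpha0.
have F0 : (0 < #|F|)%N by apply/card_gt0P; exists (0 : F).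
have {}cardA u v : adj G u v -> (8 * k.+1 * #|F| ^ d.+1 <= #|A u| * #|A v|)%N.
  move=> /cardA; rewrite -natrX -!natrM ler_nat; apply: leq_trans.
  by rewrite leq_mul2l leq_pexp2l ?orbT //; lia.
(* The value [true] on non-edges is a mere default, as [r] is only consulted on adjacent pairs. *)
pose r u v (x y : 'rV[F]_d) := if insub [set u; v] is Some e then dotp x y == alpha e else true.
have rC u v x y : r u v x y = r v u y x by rewrite /r setUC dotpC.
(* A connected graph on at least two vertices gives [v] a neighbour, and the size condition on that
   edge is positive. *)
have A0 v : A v != set0.
  have [w vw] : exists w, adj G v w.
    have [|p [w [/set1P -> _ vw]]] := exists_frontier treeG.1 (set11 v); last by exists w.
    by apply: contraTneq hk => /(congr1 (fun U => #|pred_of_set U|)); rewrite cards1 cardsT card_ord; lia.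
  have := cardA _ _ vw; apply: contraTneq => ->.
  by rewrite cards0 mul0n -ltnNge !muln_gt0 expn_gt0 F0.
have few u v (B : {set 'rV[F]_d}) : adj G u v -> B \subset A v ->
    (#|A v| <= 2 * #|B|)%N ->
    (2 * #|'I_k.+1| * #|unmatched A r u v B| <= #|A u|)%N.
  move=> uv _ half; pose e : edge G := Sub [set u; v] uv.
  have : (#|unmatched A r u v B| <= #|undotted B (alpha e)|)%N.
    apply/subset_leq_card/subsetP => x; rewrite !inE => /andP[_ /forall_inP xB].
    by apply/forall_inP => y /xB; rewrite /r insubT.
  have Av : (0 < #|A v|)%N by rewrite card_gt0.
  have := card_undotted B (alpha0 e); have := cardA _ _ uv; rewrite card_ord.
  set b := #|unmatched _ _ _ _ _|.
  set b' := #|undotted _ _|; set Q := (#|F| ^ _)%N => cA cB bb'.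
  have : (b * #|A v| <= b' * (2 * #|B|))%N by rewrite leq_mul.
  move=> bA; have bQ : (b * #|A v| <= 4 * Q)%N by lia.
  rewrite -(leq_pmul2r Av); apply: leq_trans cA; rewrite -[leqLHS]mulnA.
  by apply: (@leq_trans (2 * k.+1 * (4 * Q))%N); [rewrite leq_mul2l bQ orbT | lia].
have [x [xA xr]] := tree_embedding rC treeG A0 few.
rewrite inE; apply/exists_inP; exists x; first by rewrite inE; apply/forallP.
apply/forallP => e; apply/forallP => u; apply/forallP => v; apply/implyP => /eqP euv.
have uv : adj G u v by rewrite /adj -euv (valP e).
by have := xr _ _ uv; rewrite /r -euv valK.
Qed.
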